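(* Let $\{\lambda_n\}$ be the spectrum of the Laplace operator on a Riemannian manifold, with eigenvalues repeated according to multiplicity and ordered as $\lambda_1\le\lambda_2\le\cdots$, $\lim_{n\to\infty}\lambda_n=\infty$. Let $N(\lambda)$ be the number of eigenvalues (with multiplicity) smaller than $\lambda$, and let $K(t)=\sum_{n}e^{-\lambda_n t}$. Then $$N(\lambda)=\frac{1}{2\pi i}\int_{c-i\infty}^{c+i\infty}K(t)\,\frac{e^{\lambda t}}{t}\,dt,\qquad c>\lim_{n\to\infty}\frac{\ln n}{\lambda_n}.$$
   Context: $N(\lambda)=\sum_{\lambda_n<\lambda}1$ is called the counting function. $K(t)=\sum_n e^{-\lambda_n t}$, a function of the complex variable $t$, is called the heat kernel (it is the heat trace). The integral is taken along the vertical line $\operatorname{Re}t=c$ in the complex plane, with $c$ a real constant.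
   Formalization: The formula is proved for λ different from every eigenvalue; at an eigenvalue λ = λ_k the integral converges only as a principal value, which equals N(λ_k) plus half the multiplicity of λ_k, so the claim fails there. *)

(* Defs.v *)
(* Stdlib reals with Coquelicot. *)
From Stdlib Require Import Reals.
From Coquelicot Require Import Coquelicot.

Open Scope R_scope.

(* A spectrum is a sequence [lam : nat -> R] indexed from 0: [lam n] is the
   (n+1)-st eigenvalue, repeated according to multiplicity. *)

Definition Cexp (z : C) : C :=
  (exp (Re z) * cos (Im z), exp (Re z) * sin (Im z)).

(* A convergent series whenever [lam] tends to infinity: all but finitely many
   of its terms are 0. *)
Definition counting_function (lam : nat -> R) (x : R) : R :=
  Series (fun n => if Rlt_dec (lam n) x then 1 else 0).

Definition heat_term (lam : nat -> R) (t : C) (n : nat) : C :=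
  Cexp (- (RtoC (lam n) * t))%C.

(* Summed componentwise, [Series] being real-valued; a meaningful value only
   where the complex series of the [heat_term lam t n] converges. *)
Definition heat_kernel (lam : nat -> R) (t : C) : C :=
  (Series (fun n => Re (heat_term lam t n)),
   Series (fun n => Im (heat_term lam t n))).

(* The contour is parametrised by [t = c + i y], so [dt = i dy]. The integral is
   an improper Riemann integral whose two ends tend to infinity independently;
   it then also exists, with the same value, as the symmetric limit of the
   integrals from [c - i T] to [c + i T]. *)
Definition is_vertical_integral (f : C -> C) (c : R) (l : C) : Prop :=
  is_RInt_gen (V := C_R_NormedModule)
    (fun y : R => (f (c, y) * Ci)%C)
    (Rbar_locally m_infty) (Rbar_locally p_infty) l.

(* Main.v *)
Require Import Defs.
From Stdlib Require Import Reals Lra Lia.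
From Coquelicot Require Import Coquelicot.
Open Scope R_scope.

(* Perron's formula without contour integration. On the line [t = c + i y] the
   n-th term of the integrand is [exp (s t) / t] with [s = x - lam n <> 0].
   Integration by parts bounds the tails of its integral by a constant times
   [exp (s c) / (|s| T)]. For the value of the symmetric integral, let [F s] be
   the integral over [0, T] of the real part: [F' s = exp (s c) sin (s T) / s], so,
   again by parts, [F s] is [O (1 / T)] for [s < 0] (compare with [s -> - oo]) and,
   for [s > 0], [F s + F (- s)] is within [O (1 / T)] of
   [2 F 0 = 2 atan (T / c)], which tends to [PI]. Since [|x - lam n|] is bounded
   below and the [exp ((x - lam n) c)] are summable for [c > L], the errors can be
   summed over [n]. *)


(** * Mean value inequality and integration by parts *)

(** Both [g - f] and [g + f] have nonnegative derivative, so by the mean value theorem neither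
    decreases from [a] to [b]. *)
Lemma increment_le_of_derive_abs_le (f g df dg : R -> R) (a b : R) :
  a <= b ->
  (forall u, a <= u <= b -> is_derive f u (df u)) ->
  (forall u, a <= u <= b -> is_derive g u (dg u)) ->
  (forall u, a <= u <= b -> Rabs (df u) <= dg u) ->
  Rabs (f b - f a) <= g b - g a.
Proof.
  intros Hab Hf Hg Hle.
  assert (mono : forall h dh : R -> R,
    (forall u, a <= u <= b -> is_derive h u (dh u)) ->
    (forall u, a <= u <= b -> 0 <= dh u) -> h a <= h b).
  { intros h dh Hh Hpos.
    destruct (MVT_gen h a b dh) as [xi [Hxi Heq]];
      rewrite -> ?Rmin_left, ?Rmax_right in * by assumption.
    - intros u Hu; apply Hh; lra.
    - intros u Hu; apply continuity_pt_filterlim, (ex_derive_continuous (V := R_NormedModule)).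
      exists (dh u); apply Hh; lra.
    - specialize (Hpos xi Hxi); nra. }
  assert (H1 := mono (fun u => g u - f u) (fun u => dg u - df u)).
  assert (H2 := mono (fun u => g u + f u) (fun u => dg u + df u)).
  cbv beta in H1, H2.
  assert (g a - f a <= g b - f b).
  { apply H1; intros u Hu.
    - apply (is_derive_minus (V := R_NormedModule)); [apply Hg | apply Hf]; lra.
    - specialize (Hle u Hu); apply Rabs_le_between in Hle; lra. }
  assert (g a + f a <= g b + f b).
  { apply H2; intros u Hu.
    - apply (is_derive_plus (V := R_NormedModule)); [apply Hg | apply Hf]; lra.
    - specialize (Hle u Hu); apply Rabs_le_between in Hle; lra. }
  apply Rabs_le; lra.
Qed.

(* Integration by parts: [f - h1 sin / w + h2 cos / w] has derivative [- h1' sin / w + h2' cos / w]. *)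
Lemma oscillation_bound (f h1 h2 d1 d2 : R -> R) (w th a b : R) :
  w <> 0 -> a <= b ->
  (forall u, a <= u <= b ->
     is_derive f u (h1 u * cos (w * u + th) + h2 u * sin (w * u + th))) ->
  (forall u, a <= u <= b -> is_derive h1 u (d1 u)) ->
  (forall u, a <= u <= b -> is_derive h2 u (d2 u)) ->
  (forall u, a <= u <= b -> d1 u <= 0) ->
  (forall u, a <= u <= b -> d2 u <= 0) ->
  Rabs (f b - f a) <=
    (Rabs (h1 a) + Rabs (h1 b) + (h1 a - h1 b)
     + (Rabs (h2 a) + Rabs (h2 b) + (h2 a - h2 b))) / Rabs w.
Proof.
  intros Hw Hab Hf Hh1 Hh2 Hd1 Hd2.
  assert (Hw' : 0 < Rabs w) by now apply Rabs_pos_lt.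
  set (S u := sin (w * u + th)). set (Co u := cos (w * u + th)).
  assert (HS : forall u, Rabs (S u) <= 1)
    by (intro u; apply Rabs_le; generalize (SIN_bound (w * u + th)); unfold S; lra).
  assert (HC : forall u, Rabs (Co u) <= 1)
    by (intro u; apply Rabs_le; generalize (COS_bound (w * u + th)); unfold Co; lra).
  set (q u := f u + (h2 u * Co u - h1 u * S u) / w).
  (* As [d1] and [d2] are nonpositive, [|q'|] is at most [- (d1 + d2) / |w|], which is itself a
     derivative; no integral of [d1] or [d2] has to be formed. *)
  assert (key : Rabs (q b - q a) <=
    - ((h1 b + h2 b) / Rabs w) - - ((h1 a + h2 a) / Rabs w)).
  { apply (increment_le_of_derive_abs_le q (fun u => - ((h1 u + h2 u) / Rabs w))
      (fun u => (d2 u * Co u - d1 u * S u) / w)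
      (fun u => - ((d1 u + d2 u) / Rabs w))); trivial.
    - intros u Hu. specialize (Hf u Hu); specialize (Hh1 u Hu); specialize (Hh2 u Hu).
      unfold q, Co, S. auto_derive.
      + repeat split; try (eexists; eassumption).
      + replace (Derive (fun x => f x) u) with (h1 u * Co u + h2 u * S u)
          by (symmetry; apply is_derive_unique, Hf).
        replace (Derive (fun x => h1 x) u) with (d1 u)
          by (symmetry; apply is_derive_unique, Hh1).
        replace (Derive (fun x => h2 x) u) with (d2 u)
          by (symmetry; apply is_derive_unique, Hh2).
        unfold Co, S. field; assumption.
    - intros u Hu. specialize (Hh1 u Hu); specialize (Hh2 u Hu).
      auto_derive.
      + repeat split; try (eexists; eassumption).
      + replace (Derive (fun x => h1 x) u) with (d1 u)
          by (symmetry; apply is_derive_unique, Hh1).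
        replace (Derive (fun x => h2 x) u) with (d2 u)
          by (symmetry; apply is_derive_unique, Hh2).
        field; lra.
    - intros u Hu. unfold Rdiv. rewrite Rabs_mult, Rabs_inv, Ropp_mult_distr_l.
      apply Rmult_le_compat_r; [apply Rlt_le, Rinv_0_lt_compat; assumption|].
      unfold Rminus. eapply Rle_trans; [apply Rabs_triang|].
      rewrite Rabs_Ropp, !Rabs_mult.
      specialize (Hd1 u Hu); specialize (Hd2 u Hu); specialize (HS u); specialize (HC u).
      rewrite (Rabs_left1 (d1 u)), (Rabs_left1 (d2 u)) by assumption. nra. }
  assert (Hend : forall u, Rabs ((h2 u * Co u - h1 u * S u) / w)
     <= (Rabs (h1 u) + Rabs (h2 u)) / Rabs w).
  { intro u. unfold Rdiv. rewrite Rabs_mult, Rabs_inv.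
    apply Rmult_le_compat_r; [apply Rlt_le, Rinv_0_lt_compat; assumption|].
    unfold Rminus. eapply Rle_trans; [apply Rabs_triang|].
    rewrite Rabs_Ropp, !Rabs_mult.
    specialize (HS u); specialize (HC u).
    generalize (Rabs_pos (h1 u)) (Rabs_pos (h2 u)); nra. }
  replace (f b - f a) with ((q b - q a)
    + ((h2 a * Co a - h1 a * S a) / w - (h2 b * Co b - h1 b * S b) / w))
    by (unfold q; ring).
  eapply Rle_trans; [apply Rabs_triang|].
  eapply Rle_trans; [apply Rplus_le_compat; [exact key|]|].
  { unfold Rminus. eapply Rle_trans; [apply Rabs_triang|]. rewrite Rabs_Ropp.
    apply Rplus_le_compat; apply Hend. }
  right. field. lra.
Qed.

(** * The Perron integrand on a vertical line and its tails *)

(* With [t = c + i y], the real part of [exp (s t) / t] is [perron c s 0 y] and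
   its imaginary part is [perron c s (- PI / 2) y]. *)
Definition perron (c s th y : R) : R :=
  exp (s * c) * ((c * cos (s * y + th) + y * sin (s * y + th)) / (c * c + y * y)).

Lemma sqr_sum_pos (c y : R) : 0 < c -> 0 < c * c + y * y.
Proof. nra. Qed.

(** This bound is uniform in [y]. It serves to let [s] tend to minus infinity and as a majorant when
    sum and integral are exchanged. *)
Lemma perron_le (c s th y : R) : 0 < c -> Rabs (perron c s th y) <= exp (s * c) * (2 / c).
Proof.
  intros Hc. unfold perron, Rdiv. assert (H := sqr_sum_pos c y Hc).
  rewrite !Rabs_mult, Rabs_inv, (Rabs_right (exp _)) by (apply Rle_ge, Rlt_le, exp_pos).
  rewrite (Rabs_right (c * c + y * y)) by lra.
  apply Rmult_le_compat_l; [apply Rlt_le, exp_pos|].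
  apply (Rmult_le_reg_r (c * (c * c + y * y))); [nra|].
  replace (2 * / c * (c * (c * c + y * y))) with (2 * (c * c + y * y)) by (field; lra).
  match goal with |- Rabs ?n * _ * _ <= _ =>
    replace (Rabs n * / (c * c + y * y) * (c * (c * c + y * y))) with (c * Rabs n)
      by (field; lra);
    assert (Hn : Rabs n <= c + Rabs y) end.
  { eapply Rle_trans; [apply Rabs_triang|]. rewrite !Rabs_mult, (Rabs_right c) by lra.
    assert (Rabs (cos (s * y + th)) <= 1)
      by (apply Rabs_le; generalize (COS_bound (s * y + th)); lra).
    assert (Rabs (sin (s * y + th)) <= 1)
      by (apply Rabs_le; generalize (SIN_bound (s * y + th)); lra).
    generalize (Rabs_pos y); nra. }
  (* What remains is [c * (c + |y|) <= 2 * (c^2 + y^2)], a consequence of [(c - |y|)^2 >= 0]. *)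
  assert (Hy : y * y = Rabs y * Rabs y) by (rewrite <- Rabs_mult; symmetry; apply Rabs_right, Rle_ge, Rle_0_sqr).
  assert (Hsq := Rle_0_sqr (c - Rabs y)). unfold Rsqr in Hsq.
  apply (Rmult_le_compat_l c) in Hn; [|lra]. nra.
Qed.

Lemma perron_continuous (c s th y : R) : 0 < c -> continuous (perron c s th) y.
Proof.
  intros Hc. apply (ex_derive_continuous (V := R_NormedModule)).
  unfold perron. auto_derive. generalize (sqr_sum_pos c y Hc); lra.
Qed.

Lemma ex_RInt_perron (c s th a b : R) : 0 < c -> ex_RInt (perron c s th) a b.
Proof.
  intros Hc. apply (ex_RInt_continuous (V := R_CompleteNormedModule)).
  intros y _; now apply perron_continuous.
Qed.

Lemma perron_opp (c s th y : R) : perron c s th (- y) = perron c s (- th) y.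
Proof.
  unfold perron.
  replace (s * - y + th) with (- (s * y + - th)) by ring.
  rewrite cos_neg, sin_neg. f_equal. f_equal; ring.
Qed.

(** Integration by parts in [y] with frequency [s]. The amplitude [y / (c^2 + y^2)] peaks at [y = c]
    and decreases afterwards, whence the condition [c <= b]. *)
Lemma perron_tail (c s th b b' : R) :
  0 < c -> s <> 0 -> c <= b <= b' ->
  Rabs (RInt (perron c s th) b b') <= 4 * exp (s * c) / (Rabs s * b).
Proof.
  intros Hc Hs Hb. assert (Hs' : 0 < Rabs s) by now apply Rabs_pos_lt.
  assert (Hp := exp_pos (s * c)).
  rewrite <- (RInt_Chasles (V := R_CompleteNormedModule) _ b 0 b') by now apply ex_RInt_perron.
  rewrite <- (opp_RInt_swap (V := R_CompleteNormedModule) (perron c s th) 0 b)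
    by now apply ex_RInt_perron.
  match goal with |- Rabs ?e <= _ =>
    replace e with (RInt (perron c s th) 0 b' - RInt (perron c s th) 0 b)
      by (unfold plus, opp; simpl; ring) end.
  set (E := exp (s * c)) in *.
  set (g u := E * (c / (c * c + u * u))). set (h u := E * (u / (c * c + u * u))).
  assert (Hsq : forall u, 0 < c * c + u * u) by (intro; now apply sqr_sum_pos).
  assert (gpos : forall u, 0 <= g u).
  { intro u. unfold g. apply Rmult_le_pos; [lra|].
    apply Rlt_le, Rdiv_lt_0_compat; auto. }
  assert (hpos : forall u, 0 <= u -> 0 <= h u).
  { intros u Hu. unfold h. apply Rmult_le_pos; [lra|].
    apply Rmult_le_pos; [lra | apply Rlt_le, Rinv_0_lt_compat; auto]. }
  eapply Rle_trans; [apply (oscillation_bound _ g h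
    (fun u => - (E * (c * (2 * u) / (c * c + u * u) ^ 2)))
    (fun u => - (E * ((u * u - c * c) / (c * c + u * u) ^ 2))) s th); try lra|].
  - intros u Hu. replace (_ + _) with (perron c s th u).
    + apply (is_derive_RInt (V := R_NormedModule) _ _ 0).
      * apply filter_forall. intro z. apply (RInt_correct (V := R_CompleteNormedModule)).
        now apply ex_RInt_perron.
      * now apply perron_continuous.
    + unfold perron, g, h, E. field. generalize (Hsq u); lra.
  - intros u Hu. unfold g. specialize (Hsq u). auto_derive; [lra|]. field. lra.
  - intros u Hu. unfold h. specialize (Hsq u). auto_derive; [lra|]. field. lra.
  - intros u Hu. cbv beta. specialize (Hsq u).
    assert (0 <= E * (c * (2 * u) / (c * c + u * u) ^ 2)); [|lra].
    apply Rmult_le_pos; [lra|]. apply Rmult_le_pos; [nra|].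
    apply Rlt_le, Rinv_0_lt_compat, pow_lt; lra.
  - intros u Hu. cbv beta. specialize (Hsq u).
    assert (0 <= E * ((u * u - c * c) / (c * c + u * u) ^ 2)); [|lra].
    apply Rmult_le_pos; [lra|]. apply Rmult_le_pos; [nra|].
    apply Rlt_le, Rinv_0_lt_compat, pow_lt; lra.
  (* The amplitudes are nonnegative, so the terms at [b'] cancel and [2 * (g b + h b) / |s|]
     remains; each of [g b] and [h b] is at most [E / b]. *)
  - rewrite !Rabs_right by (apply Rle_ge; first [apply gpos | apply hpos; lra]).
    apply (Rmult_le_reg_r (Rabs s)); [lra|].
    replace (4 * E / (Rabs s * b) * Rabs s) with (4 * (E * / b)) by (field; lra).
    match goal with |- ?e / _ * _ <= _ =>
      replace (e / Rabs s * Rabs s) with (2 * (g b + h b)) by (field; lra) end.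
    assert (bound : forall v, v * b <= c * c + b * b -> E * (v / (c * c + b * b)) <= E * / b).
    { intros v Hv. apply Rmult_le_compat_l; [lra|].
      specialize (Hsq b).
      apply (Rmult_le_reg_r (b * (c * c + b * b))); [nra|].
      replace (v / (c * c + b * b) * (b * (c * c + b * b))) with (v * b) by (field; lra).
      replace (/ b * (b * (c * c + b * b))) with (c * c + b * b) by (field; lra).
      exact Hv. }
    assert (Hg := bound c ltac:(nra)). assert (Hh := bound b ltac:(nra)).
    fold (g b) in Hg. fold (h b) in Hh. lra.
Qed.

(** * Dependence on the parameter [s] and the value of the half-line integral *)

(** Differentiating [exp (s t) / t] in [s] cancels the denominator and leaves the real part of
    [exp (s t)]. *)
Lemma is_derive_perron_param (c y u : R) :
  0 < c -> is_derive (fun v => perron c v 0 y) u (exp (u * c) * cos (u * y)).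
Proof.
  intros Hc. unfold perron. assert (H := sqr_sum_pos c y Hc).
  auto_derive; [trivial|]. rewrite !Rplus_0_r. field. lra.
Qed.

Lemma is_derive_RInt_perron (c T s : R) :
  0 < c ->
  is_derive (fun u => RInt (perron c u 0) 0 T) s
    (RInt (fun y => exp (s * c) * cos (s * y)) 0 T).
Proof.
  intros Hc.
  replace (RInt (fun y => exp (s * c) * cos (s * y)) 0 T)
    with (RInt (fun y => Derive (fun u => perron c u 0 y) s) 0 T)
    by (apply RInt_ext; intros y _; now apply is_derive_unique, is_derive_perron_param).
  apply is_derive_RInt_param.
  - apply filter_forall. intros u y _. eexists. now apply is_derive_perron_param.
  - intros y _.
    apply continuity_2d_pt_ext with (fun u v => exp (u * c) * cos (u * v)).
    { intros u v. symmetry. now apply is_derive_unique, is_derive_perron_param. }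
    apply continuity_2d_pt_mult.
    + apply (continuity_1d_2d_pt_comp exp).
      { apply derivable_continuous_pt, derivable_pt_exp. }
      apply continuity_2d_pt_mult;
        [apply continuity_2d_pt_id1 | apply continuity_2d_pt_const].
    + apply (continuity_1d_2d_pt_comp cos); [apply continuity_cos|].
      apply continuity_2d_pt_mult;
        [apply continuity_2d_pt_id1 | apply continuity_2d_pt_id2].
  - apply filter_forall. intro u. now apply ex_RInt_perron.
Qed.

Lemma is_derive_RInt_perron_neq_0 (c T s : R) :
  0 < c -> s <> 0 ->
  is_derive (fun u => RInt (perron c u 0) 0 T) s (exp (s * c) * sin (s * T) / s).
Proof.
  intros Hc Hs.
  replace (exp (s * c) * sin (s * T) / s)
    with (RInt (fun y => exp (s * c) * cos (s * y)) 0 T);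
    [now apply is_derive_RInt_perron|].
  apply is_RInt_unique.
  replace (exp (s * c) * sin (s * T) / s) with
    (minus (exp (s * c) * sin (s * T) / s) (exp (s * c) * sin (s * 0) / s))
    by (unfold minus, plus, opp; simpl; rewrite Rmult_0_r, sin_0; field; lra).
  apply (is_RInt_derive (V := R_CompleteNormedModule)
    (fun y => exp (s * c) * sin (s * y) / s)).
  - intros y _. auto_derive; [trivial|]. field. lra.
  - intros y _. apply (ex_derive_continuous (V := R_NormedModule)). auto_derive. trivial.
Qed.

(** Integration by parts now runs in the parameter, with frequency [T]: the derivative of [F] is
    [h u * sin (T u)], and [h] is negative and nonincreasing on the negative axis. The integral
    [F s] is compared with [F r], which vanishes as [r] tends to minus infinity. *)
Lemma RInt_perron_neg (c s T : R) :
  0 < c -> s < 0 -> 0 < T ->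
  Rabs (RInt (perron c s 0) 0 T) <= 2 * exp (s * c) / (Rabs s * T).
Proof.
  intros Hc Hs HT.
  set (F := (fun u => RInt (perron c u 0) 0 T) : R -> R).
  set (h u := exp (u * c) / u).
  assert (hneg : forall u, u < 0 -> h u < 0).
  { intros u Hu. unfold h, Rdiv. assert (Hi := Rinv_lt_0_compat u Hu).
    assert (He := exp_pos (u * c)). nra. }
  (* Since [h] is negative, [|h r| + h r] is 0, so the bound does not depend on [r]. *)
  assert (step : forall r, r <= s -> Rabs (F s - F r) <= - 2 * h s / T).
  { intros r Hr. rewrite <- (Rabs_right T) by lra.
    eapply Rle_trans; [apply (oscillation_bound F (fun _ => 0) h (fun _ => 0)
      (fun u => exp (u * c) * (c * u - 1) / (u * u)) T 0); try lra|].
    - intros u Hu. replace (_ + _) with (exp (u * c) * sin (u * T) / u).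
      + apply is_derive_RInt_perron_neq_0; lra.
      + unfold h. rewrite Rplus_0_r, (Rmult_comm T u). field. lra.
    - intros u _. apply (is_derive_const (V := R_NormedModule)).
    - intros u Hu. unfold h. auto_derive; [lra|]. field. lra.
    - intros; lra.
    - intros u Hu. cbv beta. unfold Rdiv.
      assert (0 < / (u * u)) by (apply Rinv_0_lt_compat; nra).
      assert (c * u - 1 <= 0) by nra.
      assert (He := exp_pos (u * c)).
      assert (exp (u * c) * (c * u - 1) <= 0) by nra. nra.
    - cbv beta. rewrite Rabs_R0, !Rabs_left by (apply hneg; lra).
      right. unfold Rdiv; ring. }
  assert (far : forall r, Rabs (F r) <= exp (r * c) * (2 / c * T)).
  { intro r. unfold F. eapply Rle_trans.
    - apply (abs_RInt_le_const _ _ _ (exp (r * c) * (2 / c))); [lra| |].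
      + now apply ex_RInt_perron.
      + intros; now apply perron_le.
    - right. ring. }
  replace (2 * exp (s * c) / (Rabs s * T)) with (- 2 * h s / T)
    by (rewrite Rabs_left by lra; unfold h; field; lra).
  change (RInt (perron c s 0) 0 T) with (F s).
  apply le_epsilon. intros eps Heps.
  set (K := 2 / c * T). assert (HK : 0 < K).
  { unfold K. apply Rmult_lt_0_compat; [apply Rdiv_lt_0_compat|]; lra. }
  (* With [r = - z / c], the summand [K / eps] gives [r <= s], and [- s c > 0] gives
     [exp z >= 1 + z >= K / eps], hence [exp (r c) * K <= eps]. *)
  set (z := K / eps - s * c).
  assert (Hke : 0 < K / eps) by now apply Rdiv_lt_0_compat.
  assert (Hz : 0 < z) by (unfold z; nra).
  set (r := - (z / c)).
  assert (Hrc : r * c = - z) by (unfold r; field; lra).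
  assert (Hrs : r <= s) by (apply (Rmult_le_reg_r c); [lra|]; rewrite Hrc; unfold z; lra).
  assert (Hexp : exp (r * c) * K <= eps).
  { rewrite Hrc, exp_Ropp.
    assert (H1 : K / eps <= exp z) by (generalize (exp_ineq1_le z); unfold z in *; nra).
    assert (Hez := exp_pos z).
    apply (Rmult_le_reg_l (exp z / eps)); [now apply Rdiv_lt_0_compat|].
    replace (exp z / eps * (/ exp z * K)) with (K / eps) by (field; lra).
    replace (exp z / eps * eps) with (exp z) by (field; lra). exact H1. }
  specialize (step r Hrs). specialize (far r). fold K in far.
  replace (F s) with ((F s - F r) + F r) by ring.
  eapply Rle_trans; [apply Rabs_triang|]. lra.
Qed.

(** This is [sinh z <= z cosh z], doubled: both sides vanish at 0 and their difference has
    derivative [u * (exp u - exp (- u)) >= 0]. It makes [sinh (u c) / u] nondecreasing on the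
    positive axis. *)
Lemma sinh_le (z : R) : 0 <= z -> exp z - exp (- z) <= z * (exp z + exp (- z)).
Proof.
  intros Hz.
  assert (H := increment_le_of_derive_abs_le (fun _ => 0)
    (fun u => u * (exp u + exp (- u)) - (exp u - exp (- u)))
    (fun _ => 0) (fun u => u * (exp u - exp (- u))) 0 z Hz).
  cbv beta in H. rewrite Ropp_0, Rminus_0_r, Rabs_R0 in H.
  assert (0 <= z * (exp z + exp (- z)) - (exp z - exp (- z))
           - (0 * (exp 0 + exp 0) - (exp 0 - exp 0))); [|lra].
  apply H.
  - intros; apply (is_derive_const (V := R_NormedModule)).
  - intros u _. auto_derive; [trivial|]. ring.
  - intros u Hu. apply Rmult_le_pos; [lra|].
    destruct (Req_dec u 0) as [->|Hu0]; [rewrite Ropp_0; lra|].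
    assert (exp (- u) < exp u) by (apply exp_increasing; lra). lra.
Qed.

(** At [s = 0] the integrand is [c / (c^2 + y^2)], the derivative of [atan (y / c)]. *)
Lemma RInt_perron_0 (c T : R) : 0 < c -> RInt (perron c 0 0) 0 T = atan (T / c).
Proof.
  intros Hc. apply is_RInt_unique.
  replace (atan (T / c)) with (minus (atan (T / c)) (atan (0 / c)))
    by (unfold minus, plus, opp; simpl; unfold Rdiv; rewrite Rmult_0_l, atan_0; ring).
  apply (is_RInt_derive (V := R_CompleteNormedModule) (fun y => atan (y / c))).
  - intros y _. assert (H := sqr_sum_pos c y Hc).
    unfold perron. rewrite !Rmult_0_l, Rplus_0_r, exp_0, cos_0, sin_0.
    auto_derive; [trivial|]. unfold Rsqr; field. split; [|lra].
    replace (c ^ 2 + y ^ 2) with (c * c + y * y) by ring. lra.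
  - intros y _. now apply perron_continuous.
Qed.

(** The difference equals [- atan (1 / z)], and [atan] has derivative at most 1. *)
Lemma atan_infty_error (z : R) : 0 < z -> Rabs (atan z - PI / 2) <= / z.
Proof.
  intros Hz. assert (Hi := Rinv_0_lt_compat z Hz).
  replace (atan z - PI / 2) with (- (atan (/ z))) by (rewrite atan_inv by assumption; ring).
  rewrite Rabs_Ropp.
  replace (atan (/ z)) with (atan (/ z) - atan 0) by (rewrite atan_0; ring).
  replace (/ z) with (/ z - 0) at 2 by ring.
  apply (increment_le_of_derive_abs_le atan (fun u => u) (fun u => / (1 + u ^ 2)) (fun _ => 1)).
  - lra.
  - intros u _. auto_derive; [trivial|]. unfold Rsqr. field. nra.
  - intros u _. apply (is_derive_id (K := R_AbsRing)).
  - intros u _. rewrite Rabs_right by (apply Rle_ge, Rlt_le, Rinv_0_lt_compat; nra).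
    rewrite <- Rinv_1 at 2. apply Rinv_le_contravar; nra.
Qed.

(** The amplitude [exp (u c) / u] of the derivative of [F] is singular at 0. In
    [G u = F u + F (- u)] the two singularities combine to [k u = 2 sinh (u c) / u], which stays
    bounded there, so [G s] can be compared with [G 0]. *)
Lemma RInt_perron_sym (c s T : R) :
  0 < c -> 0 < s -> 0 < T ->
  Rabs (RInt (perron c s 0) 0 T + RInt (perron c (- s) 0) 0 T - 2 * atan (T / c))
    <= 2 * ((exp (s * c) - exp (- (s * c))) / s) / T.
Proof.
  intros Hc Hs HT.
  set (F := (fun u => RInt (perron c u 0) 0 T) : R -> R).
  set (k u := (exp (u * c) - exp (- (u * c))) / u).
  set (G u := F u + F (- u)).
  assert (kpos : forall u, 0 < u -> 0 < k u).
  { intros u Hu. unfold k. apply Rdiv_lt_0_compat; [|assumption].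
    assert (0 < u * c) by now apply Rmult_lt_0_compat.
    assert (exp (- (u * c)) < exp (u * c)) by (apply exp_increasing; lra). lra. }
  assert (HG : forall u, 0 < u -> is_derive G u (k u * sin (T * u))).
  { intros u Hu. unfold G.
    replace (k u * sin (T * u)) with
      (plus (exp (u * c) * sin (u * T) / u)
         (scal (-1) (exp (- u * c) * sin (- u * T) / - u))).
    - apply (is_derive_plus (V := R_NormedModule)).
      + apply is_derive_RInt_perron_neq_0; lra.
      + apply (is_derive_comp F (fun v => - v)).
        * apply is_derive_RInt_perron_neq_0; lra.
        * auto_derive; [trivial|]. ring.
    - unfold plus, scal, k; simpl; unfold mult; simpl.
      replace (- u * T) with (- (u * T)) by ring. rewrite sin_neg, (Rmult_comm T u).
      replace (- u * c) with (- (u * c)) by ring. field. lra. }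
  assert (step : forall e, 0 < e <= s -> Rabs (G s - G e) <= 2 * k s / T).
  { intros e He. rewrite <- (Rabs_right T) by lra.
    (* The amplitude [k] is nondecreasing, while the oscillation bound asks for nonincreasing ones;
       hence the passage to [- G] and [- k]. *)
    replace (G s - G e) with (- ((fun u => - G u) s - (fun u => - G u) e)) by (cbv beta; ring).
    rewrite Rabs_Ropp.
    eapply Rle_trans; [apply (oscillation_bound (fun u => - G u) (fun _ => 0) (fun u => - k u)
      (fun _ => 0)
      (fun u => - ((u * c * (exp (u * c) + exp (- (u * c)))
                     - (exp (u * c) - exp (- (u * c)))) / (u * u))) T 0); try lra|].
    - intros u Hu. replace (_ + _) with (opp (k u * sin (T * u)))
        by (unfold opp; simpl; rewrite Rplus_0_r; ring).
      apply (is_derive_opp (V := R_NormedModule)), HG; lra.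
    - intros u _. apply (is_derive_const (V := R_NormedModule)).
    - intros u Hu. unfold k. auto_derive; [lra|]. field. lra.
    - intros; lra.
    - intros u Hu. cbv beta.
      assert (0 <= u * c) by (apply Rmult_le_pos; lra).
      assert (Hsh := sinh_le (u * c) ltac:(assumption)).
      assert (Hi : 0 < / (u * u)) by (apply Rinv_0_lt_compat; nra).
      unfold Rdiv. apply Rge_le, Ropp_0_le_ge_contravar, Rmult_le_pos; lra.
    - cbv beta. rewrite Rabs_R0, !Rabs_Ropp, !Rabs_right by (apply Rle_ge, Rlt_le, kpos; lra).
      right. unfold Rdiv; ring. }
  assert (G0 : G 0 = 2 * atan (T / c)).
  { unfold G, F. rewrite Ropp_0, RInt_perron_0 by assumption. ring. }
  fold (F s) (F (- s)) (k s). fold (G s). rewrite <- G0.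
  (* The formula for the derivative of [G] holds for [u > 0]; the endpoint 0 is reached by
     continuity, through a small [e]. *)
  assert (HG0 : continuous G 0).
  { apply (ex_derive_continuous (V := R_NormedModule)). unfold G.
    apply (ex_derive_plus (V := R_NormedModule)).
    - eexists. now apply is_derive_RInt_perron.
    - apply (ex_derive_comp F (fun v => - v)).
      + eexists. now apply is_derive_RInt_perron.
      + auto_derive. trivial. }
  apply le_epsilon. intros eps Heps.
  destruct (proj1 (filterlim_locally G (G 0)) HG0 (mkposreal eps Heps)) as [d Hd].
  set (e := Rmin (d / 2) s).
  assert (He : 0 < e <= s).
  { split; [apply Rmin_glb_lt; [apply is_pos_div_2 | lra] | apply Rmin_r]. }
  assert (Hball : Rabs (G e - G 0) < eps).
  { apply (Hd e). change (Rabs (e - 0) < d).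
    rewrite Rminus_0_r, Rabs_right by lra.
    apply Rle_lt_trans with (d / 2); [apply Rmin_l|]. generalize (cond_pos d); lra. }
  specialize (step e He).
  replace (G s - G 0) with ((G s - G e) + (G e - G 0)) by ring.
  eapply Rle_trans; [apply Rabs_triang|]. lra.
Qed.

(** The earlier estimates only serve to identify the limit [l]. The error at [b] is then the tail
    beyond [b], whose bound has the form [exp (s c) / |s|] that can be summed over the spectrum. *)
Lemma RInt_perron_error (c s b : R) :
  0 < c -> s <> 0 -> c <= b ->
  Rabs (RInt (perron c s 0) 0 b - (if Rlt_dec 0 s then PI else 0))
    <= 4 * exp (s * c) / (Rabs s * b).
Proof.
  intros Hc Hs Hb.
  set (l := if Rlt_dec 0 s then PI else 0).
  assert (conv : exists K, 0 <= K /\ forall T, c <= T ->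
    Rabs (RInt (perron c s 0) 0 T - l) <= K / T).
  { unfold l. destruct (Rlt_dec 0 s) as [Hpos|Hneg].
    (* The three terms bound the error of the symmetric sum, the integral at [- s], and the distance
       from [2 * atan (T / c)] to [PI]. *)
    - exists (2 * ((exp (s * c) - exp (- (s * c))) / s) + 2 * exp (- s * c) / Rabs (- s) + 2 * c).
      assert (Hs' : 0 < Rabs (- s)) by (apply Rabs_pos_lt; lra).
      split.
      + assert (0 < s * c) by now apply Rmult_lt_0_compat.
        assert (exp (- (s * c)) < exp (s * c)) by (apply exp_increasing; lra).
        assert (0 < (exp (s * c) - exp (- (s * c))) / s) by (apply Rdiv_lt_0_compat; lra).
        assert (He := exp_pos (- s * c)).
        assert (0 < 2 * exp (- s * c) / Rabs (- s)) by (apply Rdiv_lt_0_compat; lra).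
        lra.
      + intros T HT.
        assert (H1 := RInt_perron_sym c s T Hc Hpos ltac:(lra)).
        assert (H2 := RInt_perron_neg c (- s) T Hc ltac:(lra) ltac:(lra)).
        assert (H3 := atan_infty_error (T / c) ltac:(apply Rdiv_lt_0_compat; lra)).
        match goal with |- _ <= ?r => replace r with
          (2 * ((exp (s * c) - exp (- (s * c))) / s) / T
            + 2 * exp (- s * c) / (Rabs (- s) * T) + 2 * / (T / c)) by (field; lra) end.
        apply Rabs_le_between in H1, H2, H3. apply Rabs_le. lra.
    - exists (2 * exp (s * c) / Rabs s).
      assert (Hs' : 0 < Rabs s) by now apply Rabs_pos_lt.
      assert (He := exp_pos (s * c)).
      split.
      + apply Rlt_le, Rdiv_lt_0_compat; lra.
      + intros T HT. rewrite Rminus_0_r.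
        replace (2 * exp (s * c) / Rabs s / T) with (2 * exp (s * c) / (Rabs s * T))
          by (field; lra).
        apply RInt_perron_neg; lra. }
  destruct conv as [K [HK conv]].
  apply le_epsilon. intros eps Heps.
  assert (Hke : 0 <= K / eps)
    by (apply Rmult_le_pos; [lra | apply Rlt_le, Rinv_0_lt_compat; lra]).
  (* This [T] lies beyond [b] and is large enough for [K / T <= eps]. *)
  set (T := b + K / eps).
  assert (HT : K / T <= eps).
  { apply (Rmult_le_reg_r (T / eps)); [apply Rdiv_lt_0_compat; unfold T; lra|].
    replace (K / T * (T / eps)) with (K / eps) by (field; unfold T; lra).
    replace (eps * (T / eps)) with T by (field; lra). unfold T; lra. }
  assert (Htail := perron_tail c s 0 b T Hc Hs ltac:(unfold T; lra)).
  specialize (conv T ltac:(unfold T; lra)).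
  rewrite <- (RInt_Chasles (V := R_CompleteNormedModule) _ 0 b T) in conv
    by now apply ex_RInt_perron.
  unfold plus in conv; simpl in conv.
  apply Rabs_le_between in Htail, conv. apply Rabs_le. lra.
Qed.

(** * Integrals over a segment of the vertical line with independent ends *)

(* The odd imaginary part cancels up to a tail between [- a] and [b]. *)
Lemma RInt_perron_line (c s m a b : R) :
  0 < c -> s <> 0 -> c <= m -> a <= - m -> m <= b ->
  Rabs (RInt (perron c s 0) a b - 2 * PI * (if Rlt_dec 0 s then 1 else 0))
    <= 8 * exp (s * c) / (Rabs s * m) /\
  Rabs (RInt (perron c s (- PI / 2)) a b) <= 8 * exp (s * c) / (Rabs s * m).
Proof.
  intros Hc Hs Hm Ha Hb.
  assert (Hs' : 0 < Rabs s) by now apply Rabs_pos_lt.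
  assert (He := exp_pos (s * c)).
  (* The segment is cut at 0 and its negative half reflected, which turns [th] into [- th]. *)
  assert (split_line : forall th, RInt (perron c s th) a b
    = RInt (perron c s (- th)) 0 (- a) + RInt (perron c s th) 0 b).
  { intro th. apply is_RInt_unique. apply (is_RInt_Chasles (V := R_NormedModule) _ a 0 b).
    - apply (is_RInt_ext (fun y => perron c s (- th) (- y))).
      { intros y _. rewrite perron_opp, Ropp_involutive. reflexivity. }
      replace (RInt (perron c s (- th)) 0 (- a)) with (opp (RInt (perron c s (- th)) (- a) 0)).
      + apply (is_RInt_ext (fun y => opp (opp (perron c s (- th) (- y)))));
          [intros; apply opp_opp|].
        apply (is_RInt_opp (V := R_NormedModule)).
        apply (is_RInt_comp_opp (V := R_NormedModule)).
        rewrite Ropp_0. apply (RInt_correct (V := R_CompleteNormedModule)).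
        now apply ex_RInt_perron.
      + apply (opp_RInt_swap (V := R_CompleteNormedModule)). now apply ex_RInt_perron.
    - apply (RInt_correct (V := R_CompleteNormedModule)). now apply ex_RInt_perron. }
  assert (weaken : forall r, m <= r ->
    4 * exp (s * c) / (Rabs s * r) <= 4 * exp (s * c) / (Rabs s * m)).
  { intros r Hr. apply Rmult_le_compat_l; [lra|].
    apply Rinv_le_contravar; [apply Rmult_lt_0_compat; lra|].
    apply Rmult_le_compat_l; lra. }
  replace (8 * exp (s * c) / (Rabs s * m)) with (2 * (4 * exp (s * c) / (Rabs s * m)))
    by (field; lra).
  split.
  - rewrite split_line, Ropp_0.
    assert (H1 := RInt_perron_error c s (- a) Hc Hs ltac:(lra)).
    assert (H2 := RInt_perron_error c s b Hc Hs ltac:(lra)).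
    assert (W1 := weaken (- a) ltac:(lra)). assert (W2 := weaken b Hb).
    destruct (Rlt_dec 0 s); apply Rabs_le_between in H1, H2; apply Rabs_le; lra.
  - rewrite split_line.
    replace (RInt (perron c s (- (- PI / 2))) 0 (- a))
      with (- RInt (perron c s (- PI / 2)) 0 (- a)).
    + assert (H0 : 0 <= 4 * exp (s * c) / (Rabs s * m)).
      { apply Rlt_le, Rdiv_lt_0_compat; [lra | apply Rmult_lt_0_compat; lra]. }
      assert (chasles : forall p q, RInt (perron c s (- PI / 2)) 0 q
        = RInt (perron c s (- PI / 2)) 0 p + RInt (perron c s (- PI / 2)) p q).
      { intros p q. symmetry. apply (RInt_Chasles (V := R_CompleteNormedModule));
          now apply ex_RInt_perron. }
      (* Either of [- a] and [b] may be the larger; the tail estimate starts at the smaller, which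
         is at least [m]. *)
      destruct (Rle_dec (- a) b).
      * rewrite (chasles (- a) b).
        assert (H := perron_tail c s (- PI / 2) (- a) b Hc Hs ltac:(lra)).
        assert (W := weaken (- a) ltac:(lra)).
        apply Rabs_le_between in H; apply Rabs_le; lra.
      * rewrite (chasles b (- a)).
        assert (H := perron_tail c s (- PI / 2) b (- a) Hc Hs ltac:(lra)).
        assert (W := weaken b Hb).
        apply Rabs_le_between in H; apply Rabs_le; lra.
    + symmetry. apply is_RInt_unique.
      apply (is_RInt_ext (fun y => opp (perron c s (- PI / 2) y))).
      { intros y _. unfold perron, opp; simpl.
        (* The phases [PI / 2] and [- PI / 2] differ by [PI], so both trigonometric factors change
           sign. *)
        replace (s * y + - (- PI / 2)) with ((s * y + - PI / 2) + PI) by field.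
        rewrite neg_cos, neg_sin. unfold Rdiv. ring. }
      apply (is_RInt_opp (V := R_NormedModule)), (RInt_correct (V := R_CompleteNormedModule)).
      now apply ex_RInt_perron.
Qed.

(** * Convergence of the heat trace to the right of [L] *)

Lemma ex_series_telescope (v : nat -> R) :
  is_lim_seq v 0 -> ex_series (fun n => v n - v (S n)).
Proof.
  intros Hv. exists (v 0%nat - 0).
  change (is_lim_seq (sum_n (fun n => v n - v (S n))) (v 0%nat - 0)).
  apply is_lim_seq_ext with (fun n => v 0%nat - v (S n)).
  - intro n. induction n as [|n IH].
    + now rewrite sum_O.
    + rewrite sum_Sn, <- IH. unfold plus; simpl. ring.
  - apply is_lim_seq_minus'; [apply is_lim_seq_const|].
    now apply (is_lim_seq_incr_1 v).
Qed.

(** The terms are [(n + 1)^(- p)]. With [q = p - 1] and [v n = (n + 1)^(- q)], the telescoping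
    difference [v n - v (n + 1)] is at least [q * (n + 2)^(- p)]. *)
Lemma ex_series_Riemann (p : R) :
  1 < p -> ex_series (fun n => exp (- (p * ln (INR (S n))))).
Proof.
  intros Hp. set (q := p - 1).
  set (v n := exp (- (q * ln (INR (S n))))).
  apply ex_series_incr_1.
  apply (ex_series_le (V := R_CompleteNormedModule) _ (fun n => / q * (v n - v (S n)))).
  - intro n. change (Rabs (exp (- (p * ln (INR (S (S n)))))) <= / q * (v n - v (S n))).
    rewrite Rabs_right by (apply Rle_ge, Rlt_le, exp_pos).
    assert (Hx : 0 < INR (S n)) by apply lt_0_INR, Nat.lt_0_succ.
    set (x := INR (S n)) in *.
    assert (Hy : INR (S (S n)) = x + 1) by apply S_INR.
    unfold v. fold x. rewrite Hy.
    (* This is [exp (- l) >= 1 - l] for [l = ln ((x + 1) / x)]. *)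
    assert (Hln : / (x + 1) <= ln (x + 1) - ln x).
    { rewrite <- ln_div by lra.
      assert (H := exp_ineq1_le (- ln ((x + 1) / x))).
      rewrite exp_Ropp, exp_ln in H by (apply Rdiv_lt_0_compat; lra).
      replace (/ ((x + 1) / x)) with (1 - / (x + 1)) in H by (field; lra). lra. }
    replace (exp (- (p * ln (x + 1)))) with (exp (- (q * ln (x + 1))) * / (x + 1)).
    2:{ replace (- (p * ln (x + 1))) with (- (q * ln (x + 1)) + - ln (x + 1))
          by (unfold q; ring).
        rewrite exp_plus, (exp_Ropp (ln (x + 1))), exp_ln by lra. reflexivity. }
    apply (Rmult_le_reg_l q); [unfold q; lra|].
    rewrite <- (Rmult_assoc q (/ q)), Rinv_r, Rmult_1_l by (unfold q; lra).
    replace (exp (- (q * ln x))) with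
      (exp (- (q * ln (x + 1))) * exp (q * (ln (x + 1) - ln x)))
      by (rewrite <- exp_plus; f_equal; ring).
    assert (He := exp_pos (- (q * ln (x + 1)))).
    assert (H1 := exp_ineq1_le (q * (ln (x + 1) - ln x))).
    assert (Hq : 0 < q) by (unfold q; lra).
    apply (Rmult_le_compat_l q) in Hln; [|lra].
    set (E := exp (- (q * ln (x + 1)))) in *.
    replace (q * (E * / (x + 1))) with (E * (q * / (x + 1))) by ring.
    replace (E * exp (q * (ln (x + 1) - ln x)) - E)
      with (E * (exp (q * (ln (x + 1) - ln x)) - 1)) by ring.
    apply Rmult_le_compat_l; lra.
  - apply (ex_series_scal_l (V := R_NormedModule) (/ q) (fun n => v n - v (S n))).
    apply ex_series_telescope. unfold v.
    apply (is_lim_seq_incr_1 (fun n => exp (- (q * ln (INR n))))).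
    apply (is_lim_comp_seq (fun y => exp (- (q * ln y))) INR p_infty 0);
      [|exists 0%nat; discriminate | apply is_lim_seq_INR].
    apply (is_lim_comp exp (fun y => - (q * ln y)) p_infty 0 m_infty);
      [apply is_lim_exp_m | | exists 0; discriminate].
    replace m_infty with (Rbar_opp p_infty) by reflexivity.
    apply is_lim_opp.
    replace p_infty with (Rbar_mult q p_infty) at 2.
    + apply is_lim_scal_l. apply is_lim_ln_p.
    + apply is_Rbar_mult_unique, is_Rbar_mult_sym, is_Rbar_mult_p_infty_pos.
      unfold q; simpl; lra.
Qed.

(** The numerators are nonnegative and [lam n] is eventually positive. In the end this yields
    [0 < c]. *)
Lemma lim_ln_div_nonneg (lam : nat -> R) (L : R) :
  is_lim_seq lam p_infty ->
  is_lim_seq (fun n => ln (INR (S n)) / lam n) L -> 0 <= L.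
Proof.
  intros Hinf Hlim.
  apply (is_lim_seq_le_loc (fun _ => 0) (fun n => ln (INR (S n)) / lam n) 0 L);
    [|apply is_lim_seq_const | exact Hlim].
  apply is_lim_seq_spec in Hinf. specialize (Hinf 0).
  revert Hinf. apply filter_imp. intros n Hn.
  apply Rmult_le_pos; [|now apply Rlt_le, Rinv_0_lt_compat].
  rewrite <- ln_1. apply ln_le; [lra|]. rewrite S_INR. generalize (pos_INR n); lra.
Qed.

(** For [L'] between [L] and [c], eventually [ln (n + 1) < L' * lam n], so the terms are at most
    [(n + 1)^(- c / L')] with exponent [c / L' > 1]. *)
Lemma ex_series_exp_spectrum (lam : nat -> R) (L c : R) :
  is_lim_seq lam p_infty ->
  is_lim_seq (fun n => ln (INR (S n)) / lam n) L ->
  L < c ->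
  ex_series (fun n => exp (- (lam n * c))).
Proof.
  intros Hinf Hlim Hc.
  assert (HL := lim_ln_div_nonneg lam L Hinf Hlim).
  (* The midpoint is positive even when [L = 0], so dividing by [L'] is legitimate. *)
  set (L' := (L + c) / 2).
  assert (HL' : L < L' < c) by (unfold L'; lra).
  apply is_lim_seq_spec in Hinf. apply is_lim_seq_spec in Hlim.
  specialize (Hinf 0). specialize (Hlim (mkposreal (L' - L) ltac:(lra))).
  destruct (filter_and _ _ Hinf Hlim) as [N HN].
  apply (ex_series_incr_n _ N).
  apply (ex_series_le (V := R_CompleteNormedModule) _
    (fun n => exp (- (c / L' * ln (INR (S (N + n))))))).
  - intro n. destruct (HN (N + n)%nat ltac:(lia)) as [Hpos Hclose].
    change (Rabs (exp (- (lam (N + n)%nat * c))) <= exp (- (c / L' * ln (INR (S (N + n)))))).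
    rewrite Rabs_right by (apply Rle_ge, Rlt_le, exp_pos).
    set (l := lam (N + n)%nat) in *. set (k := ln (INR (S (N + n)))) in *.
    simpl in Hclose. apply Rabs_lt_between in Hclose.
    assert (Hk : k < L' * l).
    { apply (Rmult_lt_reg_r (/ l)); [now apply Rinv_0_lt_compat|].
      replace (L' * l * / l) with L' by (field; lra). unfold Rdiv in Hclose. lra. }
    assert (c / L' * k <= l * c).
    { replace (l * c) with (c / L' * (L' * l)) by (field; lra).
      apply Rmult_le_compat_l; [|lra]. apply Rlt_le, Rdiv_lt_0_compat; lra. }
    destruct (Req_dec (c / L' * k) (l * c)) as [->|Hne]; [lra|].
    apply Rlt_le, exp_increasing. lra.
  - apply (ex_series_incr_n (fun n => exp (- (c / L' * ln (INR (S n))))) N).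
    apply ex_series_Riemann.
    apply (Rmult_lt_reg_r L'); [lra|]. replace (c / L' * L') with c by (field; lra). lra.
Qed.

(** * Dominated series and their termwise integration *)

Lemma ex_series_dominated (u M : nat -> R) :
  (forall n, Rabs (u n) <= M n) -> ex_series M -> ex_series u.
Proof. apply (ex_series_le (V := R_CompleteNormedModule)). Qed.

Lemma Series_Rabs_le (u M : nat -> R) :
  (forall n, Rabs (u n) <= M n) -> ex_series M -> Rabs (Series u) <= Series M.
Proof.
  intros Hle HM.
  eapply Rle_trans; [apply Series_Rabs|].
  - apply (ex_series_dominated _ M); [|assumption].
    intro n. now rewrite Rabs_Rabsolu.
  - apply Series_le; [|assumption]. intro n. split; [apply Rabs_pos | apply Hle].
Qed.

(** Weierstrass test: the majorant makes the partial sums converge uniformly in [y], and the Riemann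
    integral commutes with uniform limits. *)
Lemma is_RInt_Series (u : nat -> R -> R) (M : nat -> R) (a b : R) :
  (forall n y, Rabs (u n y) <= M n) -> ex_series M ->
  (forall n, ex_RInt (u n) a b) ->
  ex_series (fun n => RInt (u n) a b) /\
  is_RInt (fun y => Series (fun n => u n y)) a b (Series (fun n => RInt (u n) a b)).
Proof.
  intros HuM HM Hint.
  destruct (filterlim_RInt (V := R_CompleteNormedModule)
    (fun N y => sum_n (fun n => u n y) N) a b eventually _
    (fun y => Series (fun n => u n y))
    (fun N => sum_n (fun n => RInt (u n) a b) N)) as [I [HI1 HI2]].
  - intro N. induction N as [|N IH].
    + rewrite sum_O. apply (is_RInt_ext (u 0%nat)).
      { intros y _. now rewrite sum_O. }
      apply (RInt_correct (V := R_CompleteNormedModule)), Hint.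
    + rewrite sum_Sn.
      apply (is_RInt_ext (fun y => plus (sum_n (fun n => u n y) N) (u (S N) y))).
      { intros y _. now rewrite sum_Sn. }
      apply (is_RInt_plus (V := R_NormedModule)); [exact IH|].
      apply (RInt_correct (V := R_CompleteNormedModule)), Hint.
  - apply filterlim_locally. intro eps.
    assert (HMs := Series_correct _ HM).
    generalize (proj1 (filterlim_locally _ _) HMs eps).
    apply filter_imp. intros N HN y.
    change (Rabs (sum_n M N - Series M) < eps) in HN.
    change (Rabs (sum_n (fun n => u n y) N - Series (fun n => u n y)) < eps).
    (* Each remainder is itself a series, so the remainder at [y] is bounded by that of [M],
       whatever [y] is. *)
    assert (tail : forall v : nat -> R, ex_series v ->
      Series v - sum_n v N = Series (fun k => v (S N + k)%nat)).
    { intros v Hv. rewrite (Series_incr_n v (S N)) by (auto with arith).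
      rewrite sum_n_Reals. simpl Init.Nat.pred. ring. }
    assert (Hu : ex_series (fun n => u n y)) by now apply (ex_series_dominated _ M).
    rewrite Rabs_minus_sym in HN |- *.
    rewrite (tail (fun n => u n y) Hu). rewrite (tail M HM) in HN.
    eapply Rle_lt_trans; [|apply HN].
    eapply Rle_trans; [|apply Rle_abs].
    apply Series_Rabs_le; [intro; apply HuM|].
    now apply (ex_series_incr_n M (S N)).
  - assert (HI : is_series (fun n => RInt (u n) a b) I) by exact HI1.
    split; [now exists I|]. now rewrite (is_series_unique _ _ HI).
Qed.

Lemma is_series_C (u : nat -> C) (l : C) :
  is_series (fun n => Re (u n)) (Re l) -> is_series (fun n => Im (u n)) (Im l) ->
  is_series (V := C_R_NormedModule) u l.
Proof.
  intros Hre Him.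
  assert (Hsum : forall n, sum_n (G := C_R_NormedModule) u n
    = (sum_n (fun n => Re (u n)) n, sum_n (fun n => Im (u n)) n)).
  { intro n. induction n as [|n IH].
    - rewrite !sum_O. apply surjective_pairing.
    - rewrite !sum_Sn, IH. reflexivity. }
  apply filterlim_locally. intro eps.
  generalize (proj1 (filterlim_locally _ _) Hre eps) (proj1 (filterlim_locally _ _) Him eps).
  intros H1 H2. generalize (filter_and _ _ H1 H2).
  apply filter_imp. intros n [K1 K2]. rewrite Hsum. split; assumption.
Qed.

(** * The spectrum and the heat kernel on the contour *)

(** From some index on [lam n] exceeds [x + 1]; finitely many positive distances remain, and their
    minimum with 1 is taken. *)
Lemma spectral_gap (lam : nat -> R) (x : R) :
  is_lim_seq lam p_infty -> (forall n, lam n <> x) ->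
  exists delta, 0 < delta /\ forall n, delta <= Rabs (x - lam n).
Proof.
  intros Hinf Hne. apply is_lim_seq_spec in Hinf. destruct (Hinf (x + 1)) as [N HN].
  assert (Hfin : forall K, exists delta, 0 < delta <= 1 /\
    forall n, (n < K)%nat -> delta <= Rabs (x - lam n)).
  { induction K as [|K [d [Hd IH]]].
    - exists 1. split; [lra|]. intros n Hn. inversion Hn.
    - exists (Rmin d (Rabs (x - lam K))). split.
      + split; [|apply Rle_trans with d; [apply Rmin_l | lra]].
        apply Rmin_glb_lt; [lra|]. apply Rabs_pos_lt. specialize (Hne K). lra.
      + intros n Hn. destruct (Nat.eq_dec n K) as [->|HnK]; [apply Rmin_r|].
        eapply Rle_trans; [apply Rmin_l|]. apply IH. lia. }
  destruct (Hfin N) as [d [Hd HdN]].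
  exists d. split; [lra|]. intro n.
  destruct (Nat.lt_ge_cases n N) as [Hlt|Hge]; [now apply HdN|].
  specialize (HN n Hge). rewrite Rabs_left by lra. lra.
Qed.

Lemma heat_term_bounds (lam : nat -> R) (t : C) (n : nat) :
  Rabs (Re (heat_term lam t n)) <= exp (- (lam n * Re t)) /\
  Rabs (Im (heat_term lam t n)) <= exp (- (lam n * Re t)).
Proof.
  set (w := (- (RtoC (lam n) * t))%C).
  change (Rabs (exp (Re w) * cos (Im w)) <= exp (- (lam n * Re t)) /\
          Rabs (exp (Re w) * sin (Im w)) <= exp (- (lam n * Re t))).
  replace (Re w) with (- (lam n * Re t)) by (unfold w, Re; simpl; ring).
  set (z := Im w). assert (He := exp_pos (- (lam n * Re t))).
  rewrite !Rabs_mult, (Rabs_right (exp _)) by lra.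
  assert (Rabs (cos z) <= 1) by (apply Rabs_le; generalize (COS_bound z); lra).
  assert (Rabs (sin z) <= 1) by (apply Rabs_le; generalize (SIN_bound z); lra).
  split; nra.
Qed.

Lemma is_series_heat_kernel (lam : nat -> R) (t : C) :
  ex_series (fun n => exp (- (lam n * Re t))) ->
  is_series (V := C_R_NormedModule) (heat_term lam t) (heat_kernel lam t).
Proof.
  intros H. apply is_series_C; apply Series_correct;
    apply (ex_series_dominated _ (fun n => exp (- (lam n * Re t))));
    trivial; intro n; apply heat_term_bounds.
Qed.

(** The factor [Ci] from [dt = i dy] sends [A + i B] to [- B + i A], where [A + i B = exp (s t) / t]
    with [s = x - lam n]. *)
Lemma heat_term_perron (lam : nat -> R) (c x y : R) (n : nat) :
  0 < c ->
  (heat_term lam (c, y) n * (Cexp (RtoC x * (c, y)) / (c, y)) * Ci)%C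
    = (- perron c (x - lam n) (- PI / 2) y, perron c (x - lam n) 0 y).
Proof.
  intros Hc. assert (H := sqr_sum_pos c y Hc).
  unfold heat_term, Cexp, perron.
  replace (Re (- (RtoC (lam n) * (c, y)))%C) with (- lam n * c) by (simpl; ring).
  replace (Im (- (RtoC (lam n) * (c, y)))%C) with (- (lam n * y)) by (simpl; ring).
  replace (Re (RtoC x * (c, y))%C) with (x * c) by (simpl; ring).
  replace (Im (RtoC x * (c, y))%C) with (x * y) by (simpl; ring).
  replace ((x - lam n) * y + - PI / 2) with (- (PI / 2 - (x * y - lam n * y))) by field.
  rewrite !cos_neg, !sin_neg, cos_shift, sin_shift, Rplus_0_r.
  replace ((x - lam n) * y) with (x * y - lam n * y) by ring.
  replace ((x - lam n) * c) with (- lam n * c + x * c) by ring.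
  rewrite exp_plus, cos_minus, sin_minus.
  unfold Cdiv, Cinv, Cmult, Ci; simpl.
  apply injective_projections; simpl; field;
    replace (c ^ 2 + y ^ 2) with (c * c + y * y) by ring; try split; nra.
Qed.

(** The factor [exp (x t) / t] is the same for all [n], so it can be moved inside the two real
    series that make up the heat kernel. *)
Lemma perron_integrand (lam : nat -> R) (c x y : R) :
  0 < c ->
  ex_series (fun n => exp (- (lam n * c))) ->
  (heat_kernel lam (c, y) * (Cexp (RtoC x * (c, y)) / (c, y)) * Ci)%C
    = (- Series (fun n => perron c (x - lam n) (- PI / 2) y),
       Series (fun n => perron c (x - lam n) 0 y)).
Proof.
  intros Hc HM.
  assert (Hre : ex_series (fun n => Re (heat_term lam (c, y) n)))
    by (apply (ex_series_dominated _ (fun n => exp (- (lam n * c)))); trivial;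
        intro n; apply (heat_term_bounds lam (c, y))).
  assert (Him : ex_series (fun n => Im (heat_term lam (c, y) n)))
    by (apply (ex_series_dominated _ (fun n => exp (- (lam n * c)))); trivial;
        intro n; apply (heat_term_bounds lam (c, y))).
  assert (Hterm := fun n => heat_term_perron lam c x y n Hc).
  set (w := (Cexp (RtoC x * (c, y)) / (c, y))%C) in *.
  assert (E1 : forall n, perron c (x - lam n) (- PI / 2) y
    = Re (heat_term lam (c, y) n) * Im w + Im (heat_term lam (c, y) n) * Re w).
  { intro n. generalize (f_equal fst (Hterm n)). simpl. unfold Re, Im. lra. }
  assert (E2 : forall n, perron c (x - lam n) 0 y
    = Re (heat_term lam (c, y) n) * Re w - Im (heat_term lam (c, y) n) * Im w).
  { intro n. generalize (f_equal snd (Hterm n)). simpl. unfold Re, Im. lra. }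
  rewrite (Series_ext _ _ E1), (Series_ext _ _ E2).
  rewrite Series_plus, Series_minus, !Series_scal_r
    by now apply ex_series_scal_r.
  unfold heat_kernel. destruct w as [w1 w2].
  apply injective_projections; simpl; ring.
Qed.

(** * Summation of the Perron integrals over the spectrum *)

Theorem theorem2 (lam : nat -> R)
    (lam_nondecreasing : forall n : nat, lam n <= lam (S n))
    (lam_infty : is_lim_seq lam p_infty)
    (L : R) (lim_ln : is_lim_seq (fun n : nat => ln (INR (S n)) / lam n) L)
    (c : R) (c_gt : L < c)
    (x : R) (x_not_eigenvalue : forall n : nat, lam n <> x) :
  (forall t : C, Re t = c ->
     is_series (V := C_R_NormedModule) (heat_term lam t) (heat_kernel lam t)) /\
  exists I : C,
    is_vertical_integral
      (fun t : C => heat_kernel lam t * (Cexp (RtoC x * t) / t))%C c I /\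
    RtoC (counting_function lam x) = (/ (RtoC 2 * RtoC PI * Ci) * I)%C.
Proof.
  assert (Hsum := ex_series_exp_spectrum lam L c lam_infty lim_ln c_gt).
  split.
  { intros t Ht. apply is_series_heat_kernel. now rewrite Ht. }
  assert (Hc : 0 < c)
    by (generalize (lim_ln_div_nonneg lam L lam_infty lim_ln); lra).
  destruct (spectral_gap lam x lam_infty x_not_eigenvalue) as [delta [Hdelta Hgap]].
  set (s n := x - lam n).
  set (M n := exp (s n * c)).
  assert (HM : ex_series M).
  { apply (ex_series_ext (fun n => exp (x * c) * exp (- (lam n * c)))).
    - intro n. unfold M, s. rewrite <- exp_plus. f_equal. ring.
    - now apply (ex_series_scal_l (V := R_NormedModule)). }
  assert (Hs : forall n, s n <> 0)
    by (intro n; generalize (x_not_eigenvalue n); unfold s; lra).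
  set (ind n := if Rlt_dec 0 (s n) then 1 else 0).
  assert (Hcount : counting_function lam x = Series ind).
  { apply Series_ext. intro n. unfold ind, s.
    destruct (Rlt_dec (lam n) x), (Rlt_dec 0 (x - lam n)); lra. }
  (* Where the indicator is 1, [s n * c] is positive, so [M n >= 1] dominates it. *)
  assert (Hind : ex_series ind).
  { apply (ex_series_dominated _ M); [|assumption]. intro n. unfold ind, M.
    destruct (Rlt_dec 0 (s n)).
    - rewrite Rabs_R1. generalize (exp_ineq1_le (s n * c)); nra.
    - rewrite Rabs_R0. apply Rlt_le, exp_pos. }
  (* The integral is [2 PI i N(x)], a purely imaginary number. *)
  exists (0, 2 * PI * Series ind). split.
  2:{ rewrite Hcount. assert (Hpi := PI_neq0).
      apply injective_projections; simpl; field; lra. }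
  assert (Hint : forall th a b, ex_series (fun n => RInt (perron c (s n) th) a b) /\
    is_RInt (fun y => Series (fun n => perron c (s n) th y)) a b
      (Series (fun n => RInt (perron c (s n) th) a b))).
  { intros th a b. apply (is_RInt_Series (fun n => perron c (s n) th) (fun n => M n * (2 / c))).
    - intros n y. now apply perron_le.
    - now apply ex_series_scal_r.
    - intro n. now apply ex_RInt_perron. }
  intros P [eps HP].
  assert (HSM : 0 <= Series M).
  { eapply Rle_trans; [apply Rabs_pos|]. apply (Series_Rabs_le M M); [|assumption].
    intro n. rewrite Rabs_right; [lra|]. apply Rle_ge, Rlt_le, exp_pos. }
  assert (Heps := cond_pos eps).
  (* With [|s n| >= delta], the errors [8 * M n / (|s n| * m)] of the single integrals add up to at
     most [K / m]. *)
  set (K := 8 / delta * Series M).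
  assert (HK : 0 <= K).
  { apply Rmult_le_pos; [apply Rlt_le, Rdiv_lt_0_compat|]; lra. }
  assert (HKe : 0 <= K / eps)
    by (apply Rmult_le_pos; [lra | apply Rlt_le, Rinv_0_lt_compat; lra]).
  (* The summand [c] puts [m] in the range of the tail estimates and makes [K / m < eps] strict. *)
  set (m := c + K / eps).
  assert (Hm : c <= m) by (unfold m; lra).
  assert (HKm : K / m < eps).
  { apply (Rmult_lt_reg_r (m / eps)); [apply Rdiv_lt_0_compat; lra|].
    replace (K / m * (m / eps)) with (K / eps) by (field; lra).
    replace (eps * (m / eps)) with m by (field; lra). unfold m; lra. }
  assert (term_bound : forall n, 8 * exp (s n * c) / (Rabs (s n) * m) <= M n * (8 / delta / m)).
  { intro n. specialize (Hgap n). fold (s n) in Hgap. fold (M n).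
    replace (8 * M n / (Rabs (s n) * m)) with (M n * (8 / m) * / Rabs (s n)) by (field; lra).
    replace (M n * (8 / delta / m)) with (M n * (8 / m) * / delta) by (field; lra).
    apply Rmult_le_compat_l; [|now apply Rinv_le_contravar].
    apply Rmult_le_pos; [apply Rlt_le, exp_pos | apply Rlt_le, Rdiv_lt_0_compat; lra]. }
  assert (HMm : ex_series (fun n => M n * (8 / delta / m))) by now apply ex_series_scal_r.
  assert (Hsmall : Series (fun n => M n * (8 / delta / m)) < eps).
  { rewrite Series_scal_r. replace (Series M * (8 / delta / m)) with (K / m); [assumption|].
    unfold K. field. lra. }
  (* The two ends are constrained separately, as the product of the two filters demands. *)
  exists (fun a => a < - m) (fun b => m < b); [now exists (- m) | now exists m |].
  intros a b Ha Hb.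
  destruct (Hint 0 a b) as [Hre1 Hre2]. destruct (Hint (- PI / 2) a b) as [Him1 Him2].
  assert (Hline := fun n => RInt_perron_line c (s n) m a b Hc (Hs n) Hm ltac:(lra) ltac:(lra)).
  exists (- Series (fun n => RInt (perron c (s n) (- PI / 2)) a b),
          Series (fun n => RInt (perron c (s n) 0) a b)).
  split.
  (* On the contour the integrand is a pair of real series, integrated component by component. *)
  - apply (is_RInt_ext (V := C_R_NormedModule) (fun y =>
      (- Series (fun n => perron c (s n) (- PI / 2) y), Series (fun n => perron c (s n) 0 y)) : C)).
    { intros y _. symmetry. now apply perron_integrand. }
    apply (is_RInt_fct_extend_pair (U := R_NormedModule) (V := R_NormedModule)); [|exact Hre2].
    now apply (is_RInt_opp (V := R_NormedModule)).
  - apply HP. split.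
    + change (Rabs (- Series (fun n => RInt (perron c (s n) (- PI / 2)) a b) - 0) < eps).
      rewrite Rminus_0_r, Rabs_Ropp.
      eapply Rle_lt_trans; [|exact Hsmall].
      apply Series_Rabs_le; [|assumption]. intro n.
      eapply Rle_trans; [apply Hline | apply term_bound].
    + change (Rabs (Series (fun n => RInt (perron c (s n) 0) a b) - 2 * PI * Series ind) < eps).
      rewrite <- Series_scal_l, <- Series_minus;
        [|assumption | now apply (ex_series_scal_l (V := R_NormedModule))].
      eapply Rle_lt_trans; [|exact Hsmall].
      apply Series_Rabs_le; [|assumption]. intro n.
      eapply Rle_trans; [apply Hline | apply term_bound].
Qed.
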